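(* Let $(\Omega,S)$ be a scheme and $k$ a positive integer. The following are equivalent: (1) $(\Omega,S)$ is pseudocyclic with $m_P/n_P=k$ for all $P\in\mathcal P^\#$; (2) $(\Omega,S)$ is an equivalenced scheme of valency $k$ with $c(r)=k-1$ for all $r\in S^\#$. Moreover, if $(\Omega,S)$ is pseudocyclic and $n_P$ takes the same value for all $P\in\mathcal P^\#$, then $(\Omega,S)$ is commutative.
   Context: A coherent configuration is a pair $(\Omega,S)$ where $\Omega$ is a finite set and $S$ is a partition of $\Omega\times\Omega$ such that: the diagonal $1_\Omega=\{(\alpha,\alpha):\alpha\in\Omega\}$ is a union of elements of $S$; $S$ is closed under $r\mapsto r^*=\{(\beta,\alpha):(\alpha,\beta)\in r\}$; and for all $r,s,t\in S$ the number $c_{rs}^t=|\{\beta\in\Omega:(\alpha,\beta)\in r,\ (\beta,\gamma)\in s\}|$ does not depend on the choice of $(\alpha,\gamma)\in t$. A scheme is a coherent configuration with $1_\Omega\in S$; $S^\#=S\setminus\{1_\Omega\}$; for $s\in S$ and $\alpha\in\Omega$, $\alpha s=\{\beta:(\alpha,\beta)\in s\}$, and in a scheme $n_s=|\alpha s|$ does not depend on $\alpha$ (valency of $s$). A scheme is equivalenced of valency $k$ if $n_s=k$ for all $s\in S^\#$. For $s\in S$, $c(s)=\sum_{t\in S}c_{tt^*}^s$. The adjacency algebra $\mathbb{C}S$ is the span of the adjacency matrices $A(s)$, $s\in S$; let $\mathcal P$ be its set of central primitive idempotents; for $P\in\mathcal P$, $n_P$ is the dimension of an irreducible $\mathbb{C}S$-submodule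 of $\mathbb{C}^\Omega$ corresponding to $P$ and $m_P=\operatorname{rk}(P)/n_P$; $P_0=\frac1{|\Omega|}J$ and $\mathcal P^\#=\mathcal P\setminus\{P_0\}$. A scheme is pseudocyclic if $m_P/n_P$ is the same for all $P\in\mathcal P^\#$, and commutative if $\mathbb{C}S$ is commutative. *)

(* Defs.v *)
From HB Require Import structures.
From mathcomp Require Import all_boot all_order all_algebra.
From Stdlib Require Import ClassicalEpsilon.
Set Implicit Arguments. Unset Strict Implicit. Unset Printing Implicit Defensive.
Import GRing.Theory Num.Theory.
Local Open Scope ring_scope.

(* Omega is a finite type T; relations are subsets of T * T; S is a set of
   relations.  The field of complex numbers is modelled by an arbitrary
   numClosedFieldType C (algebraically closed, characteristic 0, with
   conjugation), e.g. algC. *)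

Section SchemeDefs.
Variable T : finType.
Implicit Types (r s t : {set T * T}) (S : {set {set T * T}}).

Definition diagR : {set T * T} := [set p | p.1 == p.2].
Definition transR r : {set T * T} := [set p | (p.2, p.1) \in r].
Definition nbhd r (a : T) : {set T} := [set b | (a, b) \in r].
Definition inum r s (a g : T) : nat := #|[set b | ((a, b) \in r) && ((b, g) \in s)]|.

Definition coherent_configuration S : Prop :=
  [/\ partition S [set: T * T],
      (exists D : {set {set T * T}}, D \subset S /\ cover D = diagR),
      (forall r, r \in S -> transR r \in S)
    & (forall r s t, r \in S -> s \in S -> t \in S ->
        forall a g a' g', (a, g) \in t -> (a', g') \in t ->
          inum r s a g = inum r s a' g')].

Definition scheme S : Prop := coherent_configuration S /\ diagR \in S.

Definition Ssharp S := S :\ diagR.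

Definition equivalenced S (k : nat) : Prop :=
  forall s, s \in Ssharp S -> forall a : T, #|nbhd s a| = k.

(* c(s) = sum_{t in S} c_{t t^*}^s, evaluated at a pair (a,g) in s *)
Definition cval S (a g : T) : nat := \sum_(t in S) inum t (transR t) a g.
End SchemeDefs.

Section AlgebraDefs.
Variable C : numClosedFieldType.
Variable T : finType.
Implicit Types (S : {set {set T * T}}).
Local Notation n := #|T|.
Local Notation mx := 'M[C]_n.

Definition adjmx (s : {set T * T}) : mx :=
  \matrix_(i, j) (((enum_val i, enum_val j) \in s) : nat)%:R.

Definition inCS S (M : mx) : Prop :=
  exists a : {set T * T} -> C, M = \sum_(s in S) a s *: adjmx s.

Definition central_idem S (P : mx) : Prop :=
  [/\ inCS S P, P *m P = P & forall M, inCS S M -> P *m M = M *m P].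

Definition cpi S (P : mx) : Prop :=
  [/\ central_idem S P, P != 0 &
      forall Q1 Q2, central_idem S Q1 -> central_idem S Q2 ->
        Q1 *m Q2 = 0 -> P = Q1 + Q2 -> Q1 = 0 \/ Q2 = 0].

Definition P0mx : mx := (n%:R)^-1 *: const_mx 1.

(* Subspaces of C^Omega (column vectors) are represented as row spaces of
   square matrices U: a column vector v lies in the subspace iff v^T <= U.
   M acts by v |-> M v, i.e. v^T |-> v^T M^T. *)
Definition CS_submodule S (U : mx) : Prop :=
  forall M, inCS S M -> (U *m M^T <= U)%MS.

Definition CS_irreducible S (U : mx) : Prop :=
  [/\ CS_submodule S U, \rank U != 0%N &
      forall V : mx, CS_submodule S V -> (V <= U)%MS ->
        (V == (0 : mx))%MS \/ (V == U)%MS].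

Definition irr_corr S (P U : mx) : Prop :=
  CS_irreducible S U /\ U *m P^T = U.

Definition nP S (P : mx) : nat :=
  epsilon (inhabits 0%N) (fun d => exists U, irr_corr S P U /\ \rank U = d).

Definition mP S (P : mx) : C := (\rank P)%:R / (nP S P)%:R.

Definition pseudocyclic S : Prop :=
  exists q : C, forall P, cpi S P -> P != P0mx -> mP S P / (nP S P)%:R = q.

Definition CS_commutative S : Prop :=
  forall M N, inCS S M -> inCS S N -> M *m N = N *m M.
End AlgebraDefs.

(* Main.v *)
(* The Casimir element Z = \sum_s |s|^-1 A(s) A(s)^T of the trace form of the adjacency
   algebra is central, and on an irreducible module of dimension d = n_P Schur's lemma gives
   \tr (P Z) = d^2, whence m_P / n_P = q for all P <> P0 if and only if
   Z = P0 + q^-1 (1 - P0).  Entrywise, the latter says that the scheme is equivalenced of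
   valency q with c(r) = q - 1: for t <> 1 the trace \tr (Z A(t)) = n_t - n_t / q
   is a natural number, so every n_t / q is a positive integer, while the
   average of these integers is 1.  If moreover n_P = d for all P <> P0, then
   \tr ((1 - P0) A(s)) / (q d) = - 1 / d is a sum of character values, hence an algebraic
   integer, so d = 1 and the algebra is commutative. *)
Require Import Defs.
From HB Require Import structures.
From mathcomp Require Import all_boot all_order all_algebra.
From Stdlib Require Import Classical ClassicalEpsilon.
From mathcomp Require Import ring zify.
Set Implicit Arguments. Unset Strict Implicit. Unset Printing Implicit Defensive.
Import Order.TTheory GRing.Theory Num.Theory.
Local Open Scope ring_scope.

(** * Linear maps, traces of idempotents and algebraic integers *)

Lemma linear_fun0 (R : pzRingType) (U V : lmodType R) (f : U -> V) : linear f -> f 0 = 0.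
Proof. by move=> lf; apply/(addrI (f 0)); rewrite addr0 -{1}[f 0]scale1r -lf scale1r addr0. Qed.

Lemma linear_fun_sum (R : pzRingType) (U V : lmodType R) (f : U -> V)
    (I : Type) (r : seq I) (P : pred I) (a : I -> R) (u : I -> U) :
  linear f -> f (\sum_(i <- r | P i) a i *: u i) = \sum_(i <- r | P i) a i *: f (u i).
Proof.
move=> lf; apply: (big_rec2 (fun x y => f x = y)) => [|i x y _ <-]; last by rewrite lf.
exact: linear_fun0.
Qed.

Lemma mxtrace_mul_tr (R : pzRingType) (m n : nat) (M N : 'M[R]_(m, n)) :
  \tr (M *m N^T) = \sum_i \sum_j M i j * N i j.
Proof.
apply: eq_bigr => i _; rewrite mxE; apply: eq_bigr => j _.
by rewrite mxE.
Qed.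

(** In the full-rank factorization [P = col_base P *m row_base P], idempotency forces the reversed
    product to be the identity of size [\rank P], and the trace is cyclic. *)
Lemma mxtrace_idem (F : fieldType) (n : nat) (P : 'M[F]_n) :
  P *m P = P -> \tr P = (\rank P)%:R.
Proof.
move=> PP; rewrite -{1}(mulmx_base P) mxtrace_mulC.
suff -> : row_base P *m col_base P = 1%:M by rewrite mxtrace1.
have : col_base P *m (row_base P *m col_base P) *m row_base P = col_base P *m 1%:M *m row_base P.
  by rewrite mulmx1 mulmxA mulmx_base -mulmxA !mulmx_base PP.
move/(row_free_inj (row_base_free P)) => e.
have cf : row_free (col_base P)^T.
  by rewrite -row_leq_rank mxrank_tr; have := col_base_full P; rewrite /row_full => /eqP ->.
apply: trmx_inj; apply: (row_free_inj cf); apply: trmx_inj.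
by rewrite !trmx_mul !trmxK.
Qed.

Lemma mulmx_deltaE (R : comPzRingType) (m p q r : nat) (M : 'M[R]_(m, p))
    (N : 'M_(q, r)) i j k l : (M *m delta_mx j k *m N) i l = M i j * N k l.
Proof.
by rewrite -(mul_delta_mx (0 : 'I_1)) !mulmxA -colE -mulmxA -rowE mxE big_ord1 !mxE.
Qed.

(** The rows of [B] span an invariant subspace on which [N] acts as [X]. Every eigenvalue of [X] is
    thus an eigenvalue of [N], a root of a monic polynomial over [R], and the trace is the sum of
    these eigenvalues. *)
Lemma integral_mxtrace_sub (R : comNzRingType) (K : numClosedFieldType)
    (f : {rmorphism R -> K}) (d m : nat) (X : 'M[K]_d) (B : 'M[K]_(d, m)) (N : 'M[R]_m) :
  row_free B -> X *m B = B *m map_mx f N -> integralOver f (\tr X).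
Proof.
move=> Bfree XB; case: (posnP d) => [d0|d_gt0].
  by rewrite /mxtrace big1 => [|i]; [exact: integral0|by suff: (i < 0)%N by []; rewrite -d0].
have [r] := closed_field_poly_normal (char_poly X).
rewrite (monicP (char_poly_monic X)) scale1r => hr.
have szr : size r = d.
  by apply: succn_inj; rewrite -(size_char_poly X) hr size_prod_XsubC.
(* The trace is minus the coefficient of degree [d - 1], hence the sum of the roots listed in
   [r]. *)
rewrite -[\tr X]opprK -(char_poly_trace X d_gt0) hr -{1}szr coefPn_prod_XsubC; last first.
  by rewrite szr -lt0n.
rewrite opprK big_seq; elim/big_ind: _ => [|x y|z zr]; [exact: integral0|exact: integral_add|].
have : eigenvalue X z by rewrite eigenvalue_root_char hr root_prod_XsubC.
case/eigenvalueP=> v vX v0; exists (char_poly N); first exact: char_poly_monic.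
rewrite map_char_poly -eigenvalue_root_char; apply/eigenvalueP; exists (v *m B).
  by rewrite -mulmxA -XB mulmxA vX scalemxAl.
by apply: contra_neq v0 => vB; apply: (row_free_inj Bfree); rewrite vB mul0mx.
Qed.

(** Rational root argument: clearing denominators in a monic integer equation for [1 / d] leaves
    [1 + d * q = 0] with [q] an integer, so [d] divides 1. *)
Lemma integral_natV (K : numFieldType) (d : nat) :
  (0 < d)%N -> integralOver (intr : int -> K) (d%:R^-1) -> d = 1%N.
Proof.
move=> d_gt0 [p pmon]; rewrite rootE => /eqP p0.
have d0 : (d%:R : K) != 0 by rewrite pnatr_eq0 -lt0n.
have [m szp] : exists m, size p = m.+1.
  by exists (size p).-1; rewrite prednK // lt0n size_poly_eq0 monic_neq0.
pose q : int := \sum_(i < m) p`_i * d%:Z ^+ (m - i).-1.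
suff e : (1 + d%:Z * q)%:~R = 0 :> K.
  have /eqP := e; rewrite intr_eq0 addrC addr_eq0 => /eqP dq.
  have : (d%:Z %| 1)%Z by apply/dvdzP; exists (- q); rewrite mulNr mulrC dq opprK.
  by rewrite dvdzE /= dvdn1 => /eqP.
rewrite rmorphD rmorph1 rmorphM rmorph_sum mulr_sumr /=.
have := congr1 ( *%R (d%:R ^+ m)) p0.
rewrite mulr0 horner_coef size_map_inj_poly ?rmorph0 //; last exact: intr_inj.
rewrite szp big_ord_recr /= mulrDr => e; rewrite -[RHS]e addrC; congr (_ + _).
  rewrite mulr_sumr; apply: eq_bigr => i _; rewrite coef_map /= rmorphM rmorphXn /= exprVn.
  have -> : d%:R ^+ m = d%:R ^+ (m - i).-1 * d%:R * d%:R ^+ i :> K.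
    by rewrite -exprSr -exprD prednK ?subn_gt0 // subnK // ltnW.
  by rewrite mulrACA mulfV ?expf_neq0 // mulr1 -!pmulrn; ring.
move/monicP: pmon; rewrite lead_coefE szp /= coef_map /= => ->.
by rewrite mul1r exprVn mulfV // expf_neq0.
Qed.

(** * The adjacency algebra and its trace form *)

Section AdjacencyAlgebra.
Variables (C : numClosedFieldType) (T : finType) (S : {set {set T * T}}).
Hypothesis schS : scheme S.
Local Notation n := #|T|.
Local Notation mx := 'M[C]_n.
Local Notation A := (@adjmx C T).
Local Notation ev := (@enum_val T predT).

Let partS : partition S [set: T * T]. Proof. by case: schS => [[]]. Qed.
Let trS s : s \in S -> transR s \in S. Proof. by case: schS => [[_ _ h _] _]; apply: h. Qed.
Let diagS : diagR T \in S. Proof. by case: schS. Qed.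

Definition cls (i j : 'I_n) : {set T * T} := pblock S (ev i, ev j).

Lemma cls_in i j : cls i j \in S.
Proof. by apply: pblock_mem; rewrite (cover_partition partS) inE. Qed.

Lemma mem_cls i j : (ev i, ev j) \in cls i j.
Proof. by rewrite mem_pblock (cover_partition partS) inE. Qed.

Lemma cls_eq s i j : s \in S -> (ev i, ev j) \in s -> cls i j = s.
Proof. by apply: def_pblock; case/and3P: partS. Qed.

Lemma adjmxE s i j : s \in S -> A s i j = (cls i j == s)%:R.
Proof.
move=> sS; rewrite mxE; congr (nat_of_bool _)%:R; apply/idP/eqP => [|<-].
  exact: cls_eq.
exact: mem_cls.
Qed.

Lemma class_has_pair s : s \in S -> exists i j, cls i j = s.
Proof.
move=> sS; have : s != set0 by apply: contraTneq sS => ->; case/and3P: partS.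
case/set0Pn=> -[a b] ab; exists (enum_rank a), (enum_rank b).
by apply: cls_eq; rewrite ?enum_rankK.
Qed.

Lemma cls_diag i j : (cls i j == diagR T) = (i == j).
Proof.
apply/eqP/eqP => [e|->].
  by have := mem_cls i j; rewrite e inE /= => /eqP /enum_val_inj.
by apply: cls_eq => //; rewrite inE.
Qed.

Lemma cls_refl i : cls i i = diagR T.
Proof. by apply/eqP; rewrite cls_diag. Qed.

Lemma cls_tr i j : cls j i = transR (cls i j).
Proof. by apply: cls_eq; rewrite ?trS ?cls_in // inE /= mem_cls. Qed.

Lemma sum_adjmxE (a : {set T * T} -> C) i j :
  (\sum_(s in S) a s *: A s) i j = a (cls i j).
Proof.
rewrite summxE (bigD1 (cls i j)) ?cls_in //= !mxE mem_cls mulr1.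
rewrite big1 ?addr0 // => s /andP[sS ne]; rewrite mxE adjmxE // eq_sym (negPf ne).
exact: mulr0.
Qed.

(** This turns membership in the algebra into constancy on the classes, so closure properties can be
    checked entrywise. *)
Lemma inCSP (M : mx) :
  inCS S M <-> forall i j k l, cls i j = cls k l -> M i j = M k l.
Proof.
split=> [[a ->] i j k l e | h]; first by rewrite !sum_adjmxE e.
pose a s := if [pick p : 'I_n * 'I_n | cls p.1 p.2 == s] is Some p then M p.1 p.2 else 0.
exists a; apply/matrixP=> i j; rewrite sum_adjmxE /a.
case: pickP => [[k l] /= /eqP e|/(_ (i, j))]; first exact: h.
by rewrite eqxx.
Qed.

Lemma inCS_adj s : s \in S -> inCS S (A s).
Proof. by move=> sS; apply/inCSP=> i j k l e; rewrite !adjmxE // e. Qed.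

Lemma inCSZ (c : C) (M : mx) : inCS S M -> inCS S (c *: M).
Proof. by move/inCSP=> h; apply/inCSP=> i j k l e; rewrite !mxE (h _ _ _ _ e). Qed.

Lemma inCSD (M N : mx) : inCS S M -> inCS S N -> inCS S (M + N).
Proof.
move=> /inCSP h /inCSP h'; apply/inCSP=> i j k l e.
by rewrite !mxE (h _ _ _ _ e) (h' _ _ _ _ e).
Qed.

Lemma inCSB (M N : mx) : inCS S M -> inCS S N -> inCS S (M - N).
Proof. by move=> h h'; rewrite -scaleN1r; apply/inCSD/inCSZ. Qed.

Lemma inCS0 : inCS S (0 : mx).
Proof. by apply/inCSP=> i j k l e; rewrite !mxE. Qed.

Lemma inCS_sum (I : Type) (r : seq I) (P : pred I) (M : I -> mx) :
  (forall i, P i -> inCS S (M i)) -> inCS S (\sum_(i <- r | P i) M i).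
Proof. by move=> h; elim/big_ind: _ => //; [exact: inCS0|exact: inCSD]. Qed.

Lemma inCS_const (c : C) : inCS S (const_mx c : mx).
Proof. by apply/inCSP=> i j k l e; rewrite !mxE. Qed.

Lemma adjmx_diag : A (diagR T) = 1%:M.
Proof. by apply/matrixP=> i j; rewrite adjmxE // cls_diag !mxE. Qed.

Lemma inCS1 : inCS S (1%:M : mx).
Proof. by rewrite -adjmx_diag; apply: inCS_adj. Qed.

Lemma adjmx_tr s : (A s)^T = A (transR s).
Proof. by apply/matrixP=> i j; rewrite !mxE inE. Qed.

Lemma inCS_tr (M : mx) : inCS S M -> inCS S M^T.
Proof.
move/inCSP=> h; apply/inCSP=> i j k l e; rewrite !mxE; apply: h.
by rewrite (cls_tr i j) (cls_tr k l) e.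
Qed.

Lemma adjmx_mulE r s i j : (A r *m A s) i j = (inum r s (ev i) (ev j))%:R.
Proof.
rewrite mxE /inum -sum1_card natr_sum (reindex ev) /=; last first.
  by apply: onW_bij; exact: enum_val_bij.
rewrite [RHS]big_mkcond /=; apply: eq_bigr => k _; rewrite !mxE inE.
by case: (_ \in r); case: (_ \in s); rewrite ?mulr1 ?mulr0 ?mul0r.
Qed.

Lemma inCSM (M N : mx) : inCS S M -> inCS S N -> inCS S (M *m N).
Proof.
move=> [a ->] [b ->]; rewrite mulmx_suml; apply: inCS_sum => r rS.
rewrite mulmx_sumr; apply: inCS_sum => s sS.
rewrite -scalemxAl -scalemxAr; do 2!apply: inCSZ.
apply/inCSP=> i j k l e; rewrite !adjmx_mulE; congr _%:R.
case: schS => [[_ _ _ h] _]; apply: (h _ _ (cls i j)); rewrite ?cls_in ?mem_cls //.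
by rewrite e mem_cls.
Qed.

Definition wt (s : {set T * T}) : C := (#|s|%:R)^-1.

Lemma card_class_gt0 s : s \in S -> (0 < #|s|)%N.
Proof.
by case/class_has_pair=> i [j <-]; apply/card_gt0P; exists (ev i, ev j); rewrite mem_cls.
Qed.

Lemma wt_neq0 s : s \in S -> wt s != 0.
Proof. by move=> sS; rewrite invr_eq0 pnatr_eq0 -lt0n card_class_gt0. Qed.

Lemma adjmx_sum s : \sum_i \sum_j A s i j = #|s|%:R.
Proof.
rewrite pair_big /= -[#|s|]sum1_card natr_sum.
rewrite [RHS](reindex (fun p : 'I_n * 'I_n => (ev p.1, ev p.2))) /=; last first.
  apply: onW_bij; exists (fun p => (enum_rank p.1, enum_rank p.2)) => -[a b] /=.
    by rewrite !enum_valK.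
  by rewrite !enum_rankK.
rewrite [RHS]big_mkcond; apply: eq_bigr => -[i j] _ /=; rewrite mxE.
by case: (_ \in s).
Qed.

Lemma mxtrace_adj s t : s \in S -> t \in S ->
  \tr (A s *m (A t)^T) = (#|s| * (s == t))%:R.
Proof.
move=> sS tS; rewrite mxtrace_mul_tr natrM -adjmx_sum mulr_suml.
apply: eq_bigr => i _; rewrite mulr_suml; apply: eq_bigr => j _.
rewrite !adjmxE //; case: eqP => [->|_]; rewrite ?mul0r //.
Qed.

(** The adjacency matrices are orthogonal for the form [\tr (M *m N^T)], with squared norms [#|s|];
    the coefficients are the Fourier coefficients. *)
Lemma inCS_expand (M : mx) : inCS S M ->
  M = \sum_(s in S) (wt s * \tr (M *m (A s)^T)) *: A s.
Proof.
move=> [a ->]; apply: eq_bigr => s sS; congr (_ *: _).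
rewrite mulmx_suml raddf_sum (bigD1 s) //= big1 => [|t /andP[tS ne]].
  rewrite -scalemxAl mxtraceZ mxtrace_adj // eqxx muln1 addr0 mulrCA.
  by rewrite mulVf ?mulr1 // pnatr_eq0 -lt0n card_class_gt0.
by rewrite -scalemxAl mxtraceZ mxtrace_adj // (negPf ne) muln0 mulr0.
Qed.

Lemma inCS_expand_tr (M : mx) : inCS S M ->
  M = \sum_(s in S) (wt s * \tr (M *m A s)) *: (A s)^T.
Proof.
move/inCS_tr/inCS_expand/(congr1 trmx); rewrite trmxK raddf_sum => {1}->.
by apply: eq_bigr => s _; rewrite /= linearZ /= -trmx_mul mxtrace_tr mxtrace_mulC.
Qed.

(* The tensor [\sum_s wt s A(s) (x) A(s)^T] pairs dual bases of the trace form,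
   so an endomorphism may be moved to its adjoint on the other factor. *)
Lemma casimir_adjoint (V : lmodType C) (f : mx -> mx -> V) (F G : mx -> mx) :
  (forall M, linear (f^~ M)) -> (forall M, linear (f M)) ->
  (forall M, inCS S M -> inCS S (F M)) -> (forall M, inCS S M -> inCS S (G M)) ->
  (forall M N, \tr (F M *m N) = \tr (M *m G N)) ->
  \sum_(s in S) wt s *: f (F (A s)) (A s)^T = \sum_(s in S) wt s *: f (A s) (G (A s)^T).
Proof.
move=> fl fr FS GS adj.
transitivity (\sum_(s in S) \sum_(t in S)
    (wt s * (wt t * \tr (F (A s) *m (A t)^T))) *: f (A t) (A s)^T).
  apply: eq_bigr => s sS; rewrite {1}(inCS_expand (FS _ (inCS_adj sS))).
  rewrite (linear_fun_sum _ _ _ _ (fl _)) scaler_sumr.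
  by apply: eq_bigr => t _; rewrite scalerA.
rewrite exchange_big; apply: eq_bigr => t tS /=.
rewrite [in RHS](inCS_expand_tr (GS _ (inCS_tr (inCS_adj tS)))).
rewrite (linear_fun_sum _ _ _ _ (fr _)) scaler_sumr.
apply: eq_bigr => s _; rewrite scalerA; congr (_ *: _).
by rewrite adj mxtrace_mulC mulrCA.
Qed.

(** By cyclicity of the trace, left multiplication by [M] is adjoint to right multiplication by
    [M]. *)
Lemma casimir_l (V : lmodType C) (f : mx -> mx -> V) (M : mx) :
  (forall N, linear (f^~ N)) -> (forall N, linear (f N)) -> inCS S M ->
  \sum_(s in S) wt s *: f (M *m A s) (A s)^T = \sum_(s in S) wt s *: f (A s) ((A s)^T *m M).
Proof.
move=> fl fr MS; apply: (casimir_adjoint (F := mulmx M) (G := mulmx^~ M)) => // [N|N|N N'].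
- exact: inCSM.
- by move=> NS; apply: inCSM.
- by rewrite -mulmxA mxtrace_mulC mulmxA.
Qed.

Lemma casimir_r (V : lmodType C) (f : mx -> mx -> V) (M : mx) :
  (forall N, linear (f^~ N)) -> (forall N, linear (f N)) -> inCS S M ->
  \sum_(s in S) wt s *: f (A s *m M) (A s)^T = \sum_(s in S) wt s *: f (A s) (M *m (A s)^T).
Proof.
move=> fl fr MS; apply: (casimir_adjoint (F := mulmx^~ M) (G := mulmx M)) => // [N|N|N N'].
- by move=> NS; apply: inCSM.
- exact: inCSM.
- by rewrite mulmxA.
Qed.

(** * The Casimir element: centrality and injectivity *)

Definition casimir : mx := \sum_(s in S) wt s *: (A s *m (A s)^T).

Lemma inCS_casimir : inCS S casimir.
Proof. by apply: inCS_sum => s sS; apply/inCSZ/inCSM/inCS_tr/inCS_adj/sS/inCS_adj. Qed.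

Lemma mulmx_linear_l (p q r : nat) (N : 'M[C]_(q, r)) : linear (fun M : 'M_(p, q) => M *m N).
Proof. by move=> a u v; rewrite mulmxDl scalemxAl. Qed.

Lemma mulmx_linear_r (p q r : nat) (M : 'M[C]_(p, q)) : linear (fun N : 'M_(q, r) => M *m N).
Proof. by move=> a u v; rewrite mulmxDr scalemxAr. Qed.

Lemma casimir_central M : inCS S M -> casimir *m M = M *m casimir.
Proof.
move=> MS; rewrite mulmx_suml mulmx_sumr.
have := casimir_l (@mulmx_linear_l _ _ _) (@mulmx_linear_r _ _ _) MS.
under eq_bigr do rewrite -mulmxA scalemxAr.
by under [in X in _ = X -> _]eq_bigr do rewrite mulmxA scalemxAl.
Qed.

(** The Hermitian form of [casimir] at [v] is the sum of [wt s] times the squared norm of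
    [(A s)^T *m v]. All terms are nonnegative, and the diagonal class contributes a positive
    multiple of the squared norm of [v]. *)
Lemma casimir_inj (v : 'cV[C]_n) : casimir *m v = 0 -> v = 0.
Proof.
move=> h.
pose sq m (u : 'cV[C]_m) := \tr (u *m (map_mx Num.conj u)^T).
have sqE m (u : 'cV[C]_m) : sq m u = \sum_i `|u i 0| ^+ 2.
  rewrite /sq mxtrace_mul_tr; apply: eq_bigr => i _.
  by rewrite big_ord1 mxE normCK.
have sq_ge0 m (u : 'cV[C]_m) : 0 <= sq m u.
  by rewrite sqE sumr_ge0 // => i _; rewrite exprn_ge0.
have realA s : map_mx Num.conj ((A s)^T *m v) = (A s)^T *m map_mx Num.conj v.
  rewrite map_mxM; congr (_ *m _).
  by apply/matrixP=> i j; rewrite !mxE rmorph_nat.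
have : \sum_(s in S) wt s * sq _ ((A s)^T *m v) = 0.
  have : \tr (casimir *m v *m (map_mx Num.conj v)^T) = 0 by rewrite h mul0mx mxtrace0.
  rewrite !mulmx_suml raddf_sum /= => e; rewrite -[RHS]e; apply: eq_bigr => s _.
  rewrite -!scalemxAl linearZ /=; congr (_ * _); rewrite /sq.
  by rewrite realA trmx_mul trmxK mulmxA [LHS]mxtrace_mulC !mulmxA.
move/psumr_eq0P => /(_ _ (diagR T) diagS) h0.
have : wt (diagR T) * sq _ ((A (diagR T))^T *m v) = 0.
  by apply: h0 => s sS; rewrite mulr_ge0 // invr_ge0 ler0n.
move/eqP; rewrite mulf_eq0 (negPf (wt_neq0 diagS)) /= adjmx_diag trmx1 mul1mx sqE.
move/eqP/psumr_eq0P => h1; apply/matrixP=> i j; rewrite (ord1 j) mxE.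
have /eqP := h1 (fun i _ => exprn_ge0 2 (normr_ge0 (v i 0))) i isT.
by rewrite expf_eq0 normr_eq0 => /eqP.
Qed.

(** * Irreducible representations of the adjacency algebra *)

Section Irreducible.
Variables (d : nat) (B : 'M[C]_(n, d)) (phi : mx -> 'M[C]_d).
Hypotheses (d_gt0 : (0 < d)%N) (B_neq0 : B != 0).
Hypotheses (phi_lin : linear phi) (phi1 : phi 1%:M = 1%:M).
Hypothesis phiM : forall M N, inCS S N -> phi (M *m N) = phi M *m phi N.
Hypothesis phiB : forall M, inCS S M -> M *m B = B *m phi M.
Hypothesis schur : forall X : 'M[C]_d,
  (forall M, inCS S M -> phi M *m X = X *m phi M) -> exists c, X = c%:M.

Let phi_sum (a : {set T * T} -> C) (M : {set T * T} -> mx) :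
  phi (\sum_(s in S) a s *: M s) = \sum_(s in S) a s *: phi (M s).
Proof. exact: linear_fun_sum. Qed.

Let avg_scalar X :
  exists c, \sum_(s in S) wt s *: (phi (A s) *m X *m phi (A s)^T) = c%:M.
Proof.
(* Moving [M] across the Casimir tensor shows that the average of [X] commutes with the
   representation. *)
apply: schur => M MS; rewrite mulmx_sumr mulmx_suml.
pose f (U V : mx) := phi U *m X *m phi V.
have fl N : linear (f^~ N) by move=> a U V; rewrite /f phi_lin !mulmxDl -!scalemxAl.
have fr N : linear (f N) by move=> a U V; rewrite /f phi_lin mulmxDr -scalemxAr.
have := casimir_l fl fr MS; rewrite /f.
under eq_bigr => s sS do rewrite (phiM _ (inCS_adj sS)) -!mulmxA scalemxAr !mulmxA.
under [in X in _ = X -> _]eq_bigr => s sS do rewrite (phiM _ MS) mulmxA scalemxAl.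
by [].
Qed.

(** The element of the algebra that represents the functional [M |-> \tr (X *m phi M)] under the
    trace form; see [tr_Ep]. *)
Definition Ep X : mx := \sum_(s in S) (wt s * \tr (X *m phi (A s)^T)) *: A s.

Let inCS_Ep X : inCS S (Ep X).
Proof. by apply: inCS_sum => s sS; apply/inCSZ/inCS_adj. Qed.

Let EpZ c X : Ep (c *: X) = c *: Ep X.
Proof.
rewrite scaler_sumr; apply: eq_bigr => s _.
by rewrite -scalemxAl mxtraceZ scalerA mulrCA.
Qed.

Let tr_lin X N : linear (fun M : mx => \tr (X *m phi M) *: (N : mx)).
Proof. by move=> a U V; rewrite phi_lin mulmxDr -scalemxAr mxtraceD mxtraceZ scalerDl scalerA. Qed.

(** With [Ep_r], this makes [Ep] a map of bimodules: multiplication in the algebra becomes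
    multiplication of [X] through [phi]. *)
Let Ep_l M X : inCS S M -> M *m Ep X = Ep (phi M *m X).
Proof.
move=> MS; rewrite mulmx_sumr.
pose f (U V : mx) := \tr (X *m phi V) *: U.
have fl N : linear (f^~ N).
  by move=> a U V; rewrite /f scalerDr !scalerA mulrC.
have := casimir_l fl (tr_lin X) MS; rewrite /f /=.
under eq_bigr do rewrite scalerA scalemxAr.
by move->; apply: eq_bigr => s _; rewrite scalerA phiM // mulmxA mxtrace_mulC mulmxA.
Qed.

Let Ep_r M X : inCS S M -> Ep X *m M = Ep (X *m phi M).
Proof.
move=> MS; rewrite mulmx_suml.
pose f (U V : mx) := \tr (X *m phi V) *: U.
have fl N : linear (f^~ N).
  by move=> a U V; rewrite /f scalerDr !scalerA mulrC.
have := casimir_r fl (tr_lin X) MS; rewrite /f /=.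
under eq_bigr do rewrite scalerA scalemxAl.
move->; apply: eq_bigr => s sS; rewrite scalerA phiM ?mulmxA //.
by apply/inCS_tr/inCS_adj.
Qed.

Let phiEp0 X : phi (Ep X) = X *m phi (Ep 1%:M).
Proof.
(* [K j k] averages a matrix unit, so it is scalar by [avg_scalar]. In the expansion of [phi (Ep Y)]
   at [(i, j)] only the terms with [l = i] survive, which leaves a right multiplication by [Lam]. *)
pose K j k := \sum_(s in S) wt s *: (phi (A s) *m delta_mx j k *m phi (A s)^T).
pose Lam := \matrix_(k, j) K j k k k.
suff h Y : phi (Ep Y) = Y *m Lam by rewrite !h mul1mx.
apply/matrixP=> i j; rewrite /Ep phi_sum summxE mxE.
transitivity (\sum_k \sum_l Y l k * K j k i l).
  under [RHS]eq_bigr do under eq_bigr do rewrite /K summxE mulr_sumr.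
  under [RHS]eq_bigr do rewrite exchange_big.
  rewrite [RHS]exchange_big; apply: eq_bigr => s _ /=.
  rewrite exchange_big /= [LHS]mxE mulrAC /mxtrace mulr_sumr; apply: eq_bigr => l _.
  rewrite mxE mulr_sumr; apply: eq_bigr => k _.
  rewrite mxE mulmx_deltaE; ring.
apply: eq_bigr => k _; rewrite mxE.
have [c hc] := avg_scalar (delta_mx j k); rewrite /K hc (bigD1 i) //= big1 => [|l ne].
  by rewrite !mxE !eqxx !mulr1n addr0.
by rewrite mxE eq_sym (negPf ne) mulr0.
Qed.

(** [phi (Ep 1%:M)] commutes with the representation by [Ep_l] and [Ep_r], so Schur's lemma makes it
    scalar. *)
Let lambda_ex : exists l, forall X, phi (Ep X) = l *: X.
Proof.
have [|l hl] := schur (X := phi (Ep 1%:M)).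
  by move=> M MS; rewrite -phiM // -phiM // Ep_l // Ep_r // mulmx1 mul1mx.
by exists l => X; rewrite phiEp0 hl mul_mx_scalar.
Qed.

Let tr_Ep X M : inCS S M -> \tr (Ep X *m M) = \tr (X *m phi M).
Proof.
move=> MS; rewrite {2}(inCS_expand_tr MS) phi_sum mulmx_suml mulmx_sumr !raddf_sum /=.
apply: eq_bigr => s _; rewrite -scalemxAl -scalemxAr !mxtraceZ.
by rewrite mulrAC (mxtrace_mulC M).
Qed.

(** Both sides are the trace of the operator [X |-> phi (Ep X)] on the space of [d] by [d] matrices,
    computed on the matrix units. *)
Let tr_phi_casimir l : (forall X, phi (Ep X) = l *: X) -> \tr (phi casimir) = l * (d * d)%:R.
Proof.
move=> hl; transitivity (\sum_i \sum_j phi (Ep (delta_mx i j)) i j); last first.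
  under eq_bigr do under eq_bigr do rewrite hl !mxE !eqxx mulr1.
  by rewrite !sumr_const card_ord -mulrnA mulr_natr.
rewrite /casimir phi_sum raddf_sum /=.
under [RHS]eq_bigr do under eq_bigr do rewrite /Ep phi_sum summxE.
under [RHS]eq_bigr do rewrite exchange_big.
rewrite [RHS]exchange_big; apply: eq_bigr => s sS /=.
rewrite phiM ?mxtraceZ /mxtrace ?mulr_sumr; last exact/inCS_tr/inCS_adj.
apply: eq_bigr => i _; rewrite mxE mulr_sumr; apply: eq_bigr => j _.
rewrite mxE -/(mxtrace _).
have -> : \tr (delta_mx i j *m phi (A s)^T) = phi (A s)^T j i.
  rewrite -[delta_mx i j]mul1mx /mxtrace (bigD1 i) //= mulmx_deltaE mxE eqxx mul1r.
  by rewrite big1 ?addr0 // => k ne; rewrite mulmx_deltaE mxE (negPf ne) mul0r.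
ring.
Qed.

(** [phi casimir] is scalar by Schur's lemma; were it zero, [casimir] would kill the columns of [B],
    against [casimir_inj]. *)
Let phi_casimir_neq0 : \tr (phi casimir) != 0.
Proof.
have [c hc] : exists c, phi casimir = c%:M.
  by apply: schur => M MS; rewrite -!phiM ?casimir_central //; exact: inCS_casimir.
rewrite hc mxtrace_scalar mulrn_eq0 negb_or -lt0n d_gt0 /=; apply: contra_neq B_neq0 => c0.
have := phiB inCS_casimir; rewrite hc c0 raddf0 mulmx0 => ZB.
apply/matrixP=> i j; have : col j B = 0.
  by apply: casimir_inj; rewrite colE mulmxA ZB mul0mx.
by move/matrixP/(_ i 0); rewrite !mxE.
Qed.

Variable P : mx.
Hypotheses (cpiP : cpi S P) (phiP : phi P = 1%:M).

(** The multiple [e] of [Ep 1%:M] normalized by [phi e = 1%:M] is a nonzero central idempotent below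
    [P]. Primitivity applied to [P = e + (P - e)] gives [P = e], so [P *m M] depends on [phi M]
    only. *)
Let cpi_Ep : exists2 l, l != 0 & \tr (phi casimir) = l * (d * d)%:R /\
  (forall M, inCS S M -> P *m M = l^-1 *: Ep (phi M)).
Proof.
have [l hl] := lambda_ex; have trZ := tr_phi_casimir hl.
have l0 : l != 0 by apply: contra_neq phi_casimir_neq0 => l0; rewrite trZ l0 mul0r.
exists l => //; split=> //.
have [[PS PP Pc] P0 Pmin] := cpiP.
pose e := l^-1 *: Ep 1%:M.
have eS : inCS S e by apply/inCSZ/inCS_Ep.
have eM M : inCS S M -> e *m M = l^-1 *: Ep (phi M).
  by move=> MS; rewrite -scalemxAl Ep_r // mul1mx.
have Me M : inCS S M -> M *m e = l^-1 *: Ep (phi M).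
  by move=> MS; rewrite -scalemxAr Ep_l // mulmx1.
have phie : phi e = 1%:M.
  have := @phi_lin l^-1 (Ep 1%:M) 0; rewrite addr0 -/e => ->.
  by rewrite (linear_fun0 phi_lin) addr0 hl scalerA mulVf // scale1r.
have ee : e *m e = e by rewrite eM // phie.
have Pe : P *m e = e by rewrite Me // phiP.
have eP : e *m P = e by rewrite eM // phiP.
have ec : central_idem S e by split=> // M MS; rewrite eM ?Me.
have Pec : central_idem S (P - e).
  split; first exact: inCSB.
    by rewrite mulmxBl !mulmxBr PP Pe eP ee subrr subr0.
  by move=> M MS; rewrite mulmxBl mulmxBr Pc // eM // Me.
have e0 : e != 0.
  apply: contra_neq B_neq0 => e0; have := phiB eS.
  by rewrite phie e0 mul0mx mulmx1.
have [||/eqP|/eqP] := Pmin e (P - e) ec Pec.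
- by rewrite mulmxBr eP ee subrr.
- by rewrite addrC subrK.
- by rewrite (negPf e0).
by rewrite subr_eq0 => /eqP -> M MS; exact: eM.
Qed.

Lemma irr_mxtrace_cpi M : inCS S M -> \tr (P *m M) = \tr P / d%:R * \tr (phi M).
Proof.
move=> MS; have [l l0 [_ PE]] := cpi_Ep.
have h N : inCS S N -> \tr (P *m N) = l^-1 * \tr (phi N).
  move=> NS; rewrite PE // mxtraceZ -[Ep _]mulmx1 tr_Ep ?phi1 ?mulmx1 //.
  exact: inCS1.
(* Taking [M] to be the identity identifies [l^-1] as [\tr P / d]. *)
have := h _ inCS1; rewrite mulmx1 phi1 mxtrace1 => ->.
by rewrite mulfK ?h // pnatr_eq0 -lt0n.
Qed.

Lemma irr_mxtrace_casimir : \tr (P *m casimir) = (d ^ 2)%:R.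
Proof.
have [l l0 [trZ PE]] := cpi_Ep; have ZS := inCS_casimir.
rewrite PE // mxtraceZ -[Ep _]mulmx1 tr_Ep ?phi1 ?mulmx1; last exact: inCS1.
by rewrite trZ mulKf.
Qed.

Lemma irr_central_scalar W : inCS S W -> (forall M, inCS S M -> W *m M = M *m W) ->
  exists c, P *m W = c *: P.
Proof.
move=> WS Wc; have [l l0 [trZ PE]] := cpi_Ep.
have [|c hc] := schur (X := phi W).
  by move=> M MS; rewrite -!phiM // Wc.
exists c; have := PE _ inCS1; rewrite mulmx1 phi1 => hP.
by rewrite PE // hc -scalemx1 EpZ scalerA mulrC -scalerA -hP.
Qed.

Lemma irr_dim1_comm M N : d = 1%N -> inCS S M -> inCS S N -> P *m (M *m N) = P *m (N *m M).
Proof.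
move=> d1 MS NS; have [l l0 [trZ PE]] := cpi_Ep.
rewrite !PE ?phiM //; try exact: inCSM.
congr (_ *: Ep _); move: (phi M) (phi N); rewrite d1 => X Y.
by rewrite [X]mx11_scalar [Y]mx11_scalar -!scalar_mxM mulrC.
Qed.

End Irreducible.

(** Descent on the rank, starting from the row space of [P^T], a submodule because [P] is central. A
    reducible submodule contains a nonzero one of smaller rank, still fixed by [P^T]. *)
Lemma irr_corr_ex (P : mx) : cpi S P -> exists U, irr_corr S P U.
Proof.
case=> -[PS PP Pc] P0 _.
suff h m (U : mx) : (\rank U <= m)%N -> CS_submodule S U -> \rank U != 0%N ->
    U *m P^T = U -> exists V, irr_corr S P V.
  apply: (h _ P^T (leqnn _)); rewrite -?trmx_mul ?PP //; last by rewrite mxrank_tr mxrank_eq0.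
  by move=> M MS; rewrite -trmx_mul -Pc // trmx_mul submxMl.
elim: m U => [|m IH] U rU subU U0 UP; first by move: U0; rewrite -leqn0 rU.
case: (classic (CS_irreducible S U)) => [irr|nirr]; first by exists U.
have [V [subV VU nV0 nVU]] : exists V : mx, [/\ CS_submodule S V, (V <= U)%MS,
    ~ (V == (0 : mx))%MS & ~ (V == U)%MS].
  apply: NNPP => nex; apply: nirr; split=> // V subV VU.
  case: (classic (V == (0 : mx))%MS) => [|n0]; first by left.
  by right; apply: NNPP => nU; apply: nex; exists V.
have V0 : \rank V != 0%N.
  by apply/eqP=> /eqP; rewrite mxrank_eq0 => /eqP V0; apply: nV0; rewrite V0 submx_refl.
apply: (IH V) => //; last first.
  by case/submxP: VU => X ->; rewrite -mulmxA UP.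
rewrite -ltnS; apply: leq_trans rU; rewrite ltn_neqAle mxrankS // andbT.
by apply/negP=> e; apply: nVU; rewrite -(mxrank_leqif_eq VU).
Qed.

(** Existence makes [nP] the dimension of an actual irreducible submodule instead of an arbitrary
    value of [epsilon]. *)
Lemma nP_corr (P : mx) : cpi S P -> exists U, irr_corr S P U /\ \rank U = nP S P.
Proof.
move=> /irr_corr_ex [U irrU].
apply: (epsilon_spec (inhabits 0%N) (fun d => exists U, irr_corr S P U /\ \rank U = d)).
by exists (\rank U), U.
Qed.

Lemma nP_gt0 (P : mx) : cpi S P -> (0 < nP S P)%N.
Proof. by move/nP_corr=> [U [[[_ U0 _] _] <-]]; rewrite lt0n. Qed.

(** * The representation on an irreducible submodule, in coordinates *)

Section Restriction.
Variables (P U : mx).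
Hypothesis irrU : irr_corr S P U.
Local Notation B := (row_base U)^T.

(** Row vectors are acted on by [M^T], which reverses products; the outer transpose restores their
    order. The pseudo-inverse reads off coordinates in [row_base U]. *)
Definition restr (M : mx) : 'M[C]_(\rank U) := (row_base U *m M^T *m pinvmx (row_base U))^T.

Lemma restr_lin : linear restr.
Proof.
move=> a M N; rewrite /restr linearP /= mulmxDr mulmxDl -scalemxAr -scalemxAl.
by rewrite linearP.
Qed.

Lemma restr1 : restr 1%:M = 1%:M.
Proof. by rewrite /restr trmx1 mulmx1 mulmxVp ?trmx1 ?row_base_free. Qed.

Lemma row_base_restr M : inCS S M -> row_base U *m M^T = (restr M)^T *m row_base U.
Proof.
case: irrU => -[subU _ _] _ MS; rewrite trmxK mulmxKpV //.
by rewrite eq_row_base; apply: submx_trans (subU _ MS); rewrite submxMr ?eq_row_base.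
Qed.

Lemma restrB M : inCS S M -> M *m B = B *m restr M.
Proof.
move=> MS; apply: trmx_inj; rewrite (trmx_mul M) [RHS]trmx_mul.
by rewrite (trmxK (row_base U)) row_base_restr.
Qed.

Lemma restrM M N : inCS S N -> restr (M *m N) = restr M *m restr N.
Proof.
have E X : (restr X)^T = row_base U *m X^T *m pinvmx (row_base U) by exact: trmxK.
move=> NS; apply: trmx_inj; rewrite [RHS]trmx_mul !E (trmx_mul M) (mulmxA (row_base U) N^T M^T).
rewrite [in LHS](row_base_restr NS) E.
by move: (pinvmx (row_base U)) => Q; move: (row_base U) => R; rewrite !mulmxA.
Qed.

Lemma restr_cpi : restr P = 1%:M.
Proof.
case: irrU => _ UP; have [X rU] : exists X, row_base U = X *m U.
  by apply/submxP; rewrite eq_row_base.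
by rewrite -restr1 /restr rU -!(mulmxA X) UP trmx1 mulmx1.
Qed.

(** An eigenspace of [X^T], carried into [U], is a nonzero submodule, so it is all of [U] and [X^T]
    is scalar. *)
Lemma restr_schur (X : 'M[C]_(\rank U)) :
  (forall M, inCS S M -> restr M *m X = X *m restr M) -> exists c, X = c%:M.
Proof.
move=> comX; case: irrU => -[subU U0 minU] _.
have [c /eigenvalueP [v vX v0]] := eigenvalue_closed X^T (n := \rank U) ltac:(by rewrite lt0n).
exists c; apply: trmx_inj; rewrite tr_scalar_mx; apply/eqP; rewrite -subr_eq0; apply/eqP.
set Y := _ - _; pose W := kermx Y *m row_base U.
(* [W] is in general not square; [<<W>>] is a square matrix with the same row space, as submodules
   are encoded. *)
have subW : CS_submodule S <<W>>%MS.
  move=> M MS; rewrite genmxE; suff: (W *m M^T <= W)%MS.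
    by apply: submx_trans; rewrite submxMr ?genmxE.
  rewrite /W -mulmxA row_base_restr // mulmxA submxMr //; apply/sub_kermxP.
  have -> : Y = (X - c%:M)^T by rewrite linearB /= tr_scalar_mx.
  rewrite -mulmxA -trmx_mul mulmxBl -comX // -scalar_mxC -mulmxBr trmx_mul mulmxA.
  by rewrite linearB /= tr_scalar_mx -/Y mulmx_ker mul0mx.
have WU : (<<W>> <= U)%MS.
  by rewrite genmxE; apply: submx_trans (submxMl _ _) _; rewrite eq_row_base.
have rW : \rank <<W>>%MS = \rank (kermx Y) by rewrite genmxE mxrankMfree ?row_base_free.
have [/eqmxP e|/eqmxP e] := minU _ subW WU.
  have : \rank (kermx Y) = 0%N by rewrite -rW e mxrank0.
  move/eqP; rewrite mxrank_eq0 => /eqP k0.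
  have : (v <= kermx Y)%MS by apply/sub_kermxP; rewrite mulmxBr vX mul_mx_scalar subrr.
  by rewrite k0 submx0 (negPf v0).
have : \rank (kermx Y) = \rank U by rewrite -rW e.
rewrite mxrank_ker => rY; apply/eqP; rewrite -mxrank_eq0.
by move: (rank_leq_row Y) U0 rY; case: (\rank Y) => // k; lia.
Qed.

(** The restriction of the integer matrix [(A s)^T] to an invariant subspace has algebraic integers
    as eigenvalues. *)
Lemma restr_trace_integral s : s \in S -> integralOver (intr : int -> C) (\tr (restr (A s))).
Proof.
move=> sS; rewrite -mxtrace_tr.
pose N : 'M[int]_n := \matrix_(i, j) ((ev j, ev i) \in s)%:R.
apply: (@integral_mxtrace_sub _ _ _ _ _ _ _ N (row_base_free U)).
rewrite -row_base_restr; last exact: inCS_adj.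
congr (_ *m _).
by apply/matrixP=> i j; rewrite !mxE rmorph_nat.
Qed.

End Restriction.

(** * Trace, centre and character values at a central primitive idempotent *)

Section CentralPrimitive.
Variable P : mx.
Hypothesis cpiP : cpi S P.

Let baseT_neq0 U : irr_corr S P U -> (row_base U)^T != 0.
Proof.
case=> -[_ U0 _] _; apply: contra_neqN U0 => /eqP /(congr1 trmx).
by rewrite trmxK trmx0 => e; rewrite -(eq_row_base U) e mxrank0.
Qed.

Lemma cpi_mxtrace_casimir : \tr (P *m casimir) = (nP S P ^ 2)%:R.
Proof.
have [U [irrU <-]] := nP_corr cpiP.
have U_gt0 : (0 < \rank U)%N by case: irrU => -[_ U0 _] _; rewrite lt0n.
exact: (irr_mxtrace_casimir U_gt0 (baseT_neq0 irrU) (@restr_lin U) (restr1 U)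
  (restrM irrU) (restrB irrU) (restr_schur irrU) cpiP (restr_cpi irrU)).
Qed.

Lemma cpi_central_scalar W : inCS S W -> (forall M, inCS S M -> W *m M = M *m W) ->
  exists c, P *m W = c *: P.
Proof.
have [U [irrU _]] := nP_corr cpiP.
have U_gt0 : (0 < \rank U)%N by case: irrU => -[_ U0 _] _; rewrite lt0n.
exact: (irr_central_scalar U_gt0 (baseT_neq0 irrU) (@restr_lin U) (restr1 U)
  (restrM irrU) (restrB irrU) (restr_schur irrU) cpiP (restr_cpi irrU)).
Qed.

Lemma cpi_dim1_comm M N : nP S P = 1%N -> inCS S M -> inCS S N ->
  P *m (M *m N) = P *m (N *m M).
Proof.
have [U [irrU <-]] := nP_corr cpiP.
have U_gt0 : (0 < \rank U)%N by case: irrU => -[_ U0 _] _; rewrite lt0n.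
exact: (irr_dim1_comm U_gt0 (baseT_neq0 irrU) (@restr_lin U)
  (restrM irrU) (restrB irrU) (restr_schur irrU) cpiP (restr_cpi irrU)).
Qed.

Lemma cpi_trace_integral s : s \in S ->
  exists2 x, integralOver (intr : int -> C) x & \tr (P *m A s) = \tr P / (nP S P)%:R * x.
Proof.
have [U [irrU <-]] := nP_corr cpiP => sS.
have U_gt0 : (0 < \rank U)%N by case: irrU => -[_ U0 _] _; rewrite lt0n.
exists (\tr (restr U (A s))); first exact: (restr_trace_integral irrU sS).
exact: (irr_mxtrace_cpi U_gt0 (baseT_neq0 irrU) (@restr_lin U) (restr1 U)
  (restrM irrU) (restrB irrU) (restr_schur irrU) cpiP (restr_cpi irrU) (inCS_adj sS)).
Qed.

End CentralPrimitive.

(** * Central idempotents and the principal idempotent *)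

(** Strong induction on the rank: a nonzero central idempotent that is not primitive splits into two
    nonzero orthogonal ones, and their ranks add because ranks of idempotents are traces. *)
Lemma central_idem_ind (R : mx -> Prop) :
  R 0 -> (forall P, cpi S P -> R P) ->
  (forall Q1 Q2, central_idem S Q1 -> central_idem S Q2 -> Q1 *m Q2 = 0 ->
     R Q1 -> R Q2 -> R (Q1 + Q2)) ->
  forall Q, central_idem S Q -> R Q.
Proof.
move=> R0 Rcpi RD Q; have [m] := ubnP (\rank Q); elim: m Q => // m IH Q rQ cQ.
case: (eqVneq Q 0) => [->//|Q0].
case: (classic (cpi S Q)) => [|ncpi]; first exact: Rcpi.
have [Q1 [Q2 [c1 c2 Q12 [QE /eqP n1 /eqP n2]]]] : exists Q1 Q2,
    [/\ central_idem S Q1, central_idem S Q2, Q1 *m Q2 = 0 & [/\ Q = Q1 + Q2, Q1 <> 0 & Q2 <> 0]].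
  apply: NNPP => nex; apply: ncpi; split=> // Q1 Q2 c1 c2 Q12 QE.
  case: (classic (Q1 = 0)) => [|n1]; first by left.
  by right; apply: NNPP => n2; apply: nex; exists Q1, Q2.
have rkD : \rank Q = (\rank Q1 + \rank Q2)%N.
  apply/eqP; rewrite -(eqr_nat C) natrD.
  case: cQ c1 c2 => [_ QQ _] [_ QQ1 _] [_ QQ2 _].
  by rewrite -!mxtrace_idem // QE mxtraceD.
rewrite QE; apply: RD => //; apply: IH => //; rewrite ltnS in rQ; apply: leq_trans rQ; rewrite rkD.
  by rewrite -[X in (X < _)%N]addn0 ltn_add2l lt0n mxrank_eq0.
by rewrite -[X in (X < _)%N]add0n ltn_add2r lt0n mxrank_eq0.
Qed.

Local Notation P0 := (P0mx C T).

Lemma card_base_neq0 : (n%:R : C) != 0.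
Proof.
have [i _] := class_has_pair diagS.
by rewrite pnatr_eq0 -lt0n; apply: leq_ltn_trans (ltn_ord i).
Qed.

Lemma P0E i j : P0 i j = n%:R^-1.
Proof. by rewrite !mxE mulr1. Qed.

Lemma inCS_P0 : inCS S P0.
Proof. exact/inCSZ/inCS_const. Qed.

Lemma P0_idem : P0 *m P0 = P0.
Proof.
apply/matrixP=> i j; rewrite mxE; under eq_bigr do rewrite !P0E.
by rewrite P0E sumr_const card_ord -[_ *+ n]mulr_natr mulfVK ?card_base_neq0.
Qed.

Lemma mxtrace_mul_P0 (M : mx) : \tr (M *m P0) = n%:R^-1 * \sum_i \sum_j M i j.
Proof.
rewrite mulr_sumr; apply: eq_bigr => i _; rewrite mxE mulr_sumr.
by apply: eq_bigr => j _; rewrite P0E mulrC.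
Qed.

Lemma mxtrace_P0 : \tr P0 = 1.
Proof.
rewrite /mxtrace; under eq_bigr do rewrite P0E.
by rewrite sumr_const card_ord -[_ *+ n]mulr_natr mulVf ?card_base_neq0.
Qed.

Lemma P0_neq0 : P0 != 0.
Proof. by apply: contra_eq_neq mxtrace_P0 => ->; rewrite mxtrace0 eq_sym oner_neq0. Qed.

Lemma mul_inCS_P0 M : inCS S M -> M *m P0 = \tr (M *m P0) *: P0.
Proof.
move=> MS; have [i0 _] := class_has_pair diagS.
have [c hc] : exists c, M *m P0 = c *: P0.
  exists (n%:R * (M *m P0) i0 i0); apply/matrixP=> i j.
  rewrite [RHS]mxE P0E mulrAC mulfV ?card_base_neq0 // mul1r.
  transitivity ((M *m P0) i i).
    by rewrite !mxE; apply: eq_bigr => k _; rewrite !P0E.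
  have /inCSP := inCSM MS inCS_P0; apply.
  by rewrite !cls_refl.
by rewrite hc mxtraceZ mxtrace_P0 mulr1.
Qed.

Lemma P0_tr : P0^T = P0.
Proof. by apply/matrixP=> i j; rewrite mxE !P0E. Qed.

Lemma P0_mul_inCS M : inCS S M -> P0 *m M = \tr (M *m P0) *: P0.
Proof.
move=> MS; apply: trmx_inj; rewrite trmx_mul P0_tr (mul_inCS_P0 (inCS_tr MS)) [RHS]linearZ /= P0_tr.
by rewrite -{1}P0_tr -trmx_mul mxtrace_tr mxtrace_mulC.
Qed.

Lemma central_idem_P0 : central_idem S P0.
Proof.
split; [exact: inCS_P0|exact: P0_idem|move=> M MS].
by rewrite P0_mul_inCS // [RHS]mul_inCS_P0.
Qed.

Lemma central_idem_compl (P : mx) : central_idem S P -> central_idem S (1%:M - P).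
Proof.
move=> [PS PP Pc]; split; first exact/inCSB/PS/inCS1.
  by rewrite mulmxBl mul1mx mulmxBr mulmx1 PP subrr subr0.
by move=> M MS; rewrite mulmxBl mulmxBr mul1mx mulmx1 Pc.
Qed.

(** The factor [c] in [P *m P0 = c *: P0] satisfies [c * c = c]. If [c = 1], then
    [P = P0 + (P - P0)] is an orthogonal splitting, and primitivity forces [P = P0]. *)
Lemma cpi_mul_P0 (P : mx) : cpi S P -> P != P0 -> P *m P0 = 0.
Proof.
move=> [[PS PP Pc] Pn0 Pmin] neP.
have PE := mul_inCS_P0 PS; set c := \tr _ in PE.
have : (c * c - c) *: P0 = 0.
  by rewrite scalerBl -PE -scalerA -PE -{2}PP scalemxAr -PE mulmxA subrr.
move/eqP; rewrite scaler_eq0 (negPf P0_neq0) orbF -{3}[c]mulr1 -mulrBr mulf_eq0.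
case/orP=> [/eqP c0|]; first by rewrite PE c0 scale0r.
rewrite subr_eq0 => /eqP c1; rewrite c1 scale1r in PE.
have P0P : P0 *m P = P0 by rewrite -Pc ?PE //; exact: inCS_P0.
have [|||/eqP|/eqP] := Pmin P0 (P - P0) central_idem_P0.
- split; first exact/inCSB/inCS_P0.
    by rewrite mulmxBl !mulmxBr PP PE P0P P0_idem subrr subr0.
  by move=> M MS; rewrite mulmxBl mulmxBr Pc //; congr (_ - _); case: central_idem_P0 => _ _; apply.
- by rewrite mulmxBr P0P P0_idem subrr.
- by rewrite addrC subrK.
- by rewrite (negPf P0_neq0).
by rewrite subr_eq0 (negPf neP).
Qed.

(** Orthogonality to [P0] passes to both summands of a splitting and excludes [P0] itself, so the
    induction reaches only the other primitive idempotents. It replaces a sum over all of them. *)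
Lemma central_idem_P0_ind (R : mx -> Prop) :
  R 0 -> (forall P, cpi S P -> P != P0 -> R P) ->
  (forall Q1 Q2, R Q1 -> R Q2 -> R (Q1 + Q2)) -> R (1%:M - P0).
Proof.
move=> R0 Rcpi RD.
suff h Q : central_idem S Q -> Q *m P0 = 0 -> R Q.
  apply: h; first exact/central_idem_compl/central_idem_P0.
  by rewrite mulmxBl mul1mx P0_idem subrr.
move: Q; apply: central_idem_ind => [_|P cP PP0|Q1 Q2 [Q1S Q11 Q1c] [Q2S Q22 Q2c] Q12 R1 R2 QP0] //.
  apply: Rcpi => //; apply: contraTneq P0_neq0 => PE.
  by rewrite -P0_idem -{1}PE PP0 eqxx.
have Q21 : Q2 *m Q1 = 0 by rewrite -Q1c.
apply: RD; [apply: R1|apply: R2].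
  suff -> : Q1 *m P0 = Q1 *m ((Q1 + Q2) *m P0) by rewrite QP0 mulmx0.
  by rewrite mulmxA mulmxDr Q11 Q12 addr0.
suff -> : Q2 *m P0 = Q2 *m ((Q1 + Q2) *m P0) by rewrite QP0 mulmx0.
by rewrite mulmxA mulmxDr Q22 Q21 add0r.
Qed.

(** * The Casimir element and valencies *)

Lemma adjmx_mul_P0 s : s \in S -> A s *m P0 = (#|s|%:R / n%:R) *: P0.
Proof.
by move=> sS; rewrite mul_inCS_P0 ?mxtrace_mul_P0 ?adjmx_sum 1?mulrC //; exact: inCS_adj.
Qed.

(** Compare entries in [A s *m P0 = (#|s| / n) *: P0]: every row of [A s] has sum [#|s| / n]. *)
Lemma card_class s a : s \in S -> #|s| = (#|nbhd s a| * n)%N.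
Proof.
move=> sS; apply/eqP; rewrite -(eqr_nat C) natrM.
have := congr1 (fun M : mx => M (enum_rank a) (enum_rank a)) (adjmx_mul_P0 sS) => /=.
rewrite mxE [in RHS]mxE P0E; under eq_bigr do rewrite P0E.
rewrite -mulr_suml => /(mulIf (invr_neq0 card_base_neq0)) => e.
suff <- : \sum_j A s (enum_rank a) j = #|nbhd s a|%:R by rewrite e mulfVK ?card_base_neq0.
rewrite -sum1_card natr_sum [RHS](reindex ev) /=; last by apply: onW_bij; exact: enum_val_bij.
rewrite [RHS]big_mkcond; apply: eq_bigr => j _ /=; rewrite mxE enum_rankK inE.
by case: (_ \in s).
Qed.

Lemma sum_card_class : \sum_(s in S) #|s| = (n * n)%N.
Proof. by rewrite -(card_partition partS) cardsT card_prod. Qed.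

Lemma card_diag : #|diagR T| = n.
Proof.
have [i _] := class_has_pair diagS.
rewrite (card_class (ev i) diagS).
suff -> : nbhd (diagR T) (ev i) = [set ev i] by rewrite cards1 mul1n.
by apply/setP=> b; rewrite !inE eq_sym.
Qed.

Lemma casimir_P0 : casimir *m P0 = P0.
Proof.
have trP0 s : s \in S -> (A s)^T *m P0 = (#|s|%:R / n%:R) *: P0.
  move=> sS; rewrite (mul_inCS_P0 (inCS_tr (inCS_adj sS))); congr (_ *: _).
  rewrite mxtrace_mul_P0 -adjmx_sum mulrC exchange_big /=.
  by under eq_bigr do under eq_bigr do rewrite mxE.
rewrite mulmx_suml.
(* Each product contributes [(#|s| / n) ^ 2], one factor [#|s|] of which cancels the weight; the
   classes partition the [n * n] pairs. *)
transitivity (\sum_(s in S) (#|s|%:R / (n * n)%:R) *: P0).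
  apply: eq_bigr => s sS; rewrite -scalemxAl -mulmxA trP0 // -scalemxAr adjmx_mul_P0 // !scalerA.
  congr (_ *: _); rewrite natrM /wt; have := wt_neq0 sS; rewrite invr_eq0 => s0.
  by field; rewrite s0 card_base_neq0.
rewrite -scaler_suml -mulr_suml -natr_sum sum_card_class mulfV ?scale1r //.
by rewrite natrM mulf_neq0 ?card_base_neq0.
Qed.

Lemma mxtrace_casimir : \tr casimir = #|S|%:R.
Proof.
rewrite /casimir raddf_sum /= -[#|S|]sum1_card natr_sum; apply: eq_bigr => s sS.
by rewrite mxtraceZ mxtrace_adj // eqxx muln1 /wt mulVf // -invr_eq0 wt_neq0.
Qed.

Definition casimir_form (q : C) := casimir = P0 + q^-1 *: (1%:M - P0).

Lemma cpi_mxtrace (P : mx) : cpi S P -> \tr P = (\rank P)%:R /\ 0 < \tr P.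
Proof.
case=> -[_ PP _] Pn0 _; rewrite mxtrace_idem //; split=> //.
by rewrite ltr0n lt0n mxrank_eq0.
Qed.

Lemma casimir_formP (q : C) : q != 0 ->
  (forall P, cpi S P -> P != P0 -> \tr P = q * (nP S P ^ 2)%:R) <-> casimir_form q.
Proof.
move=> q0; split=> [h|hZ P cP PP0]; last first.
  have PP0_0 := cpi_mul_P0 cP PP0.
  rewrite -cpi_mxtrace_casimir // hZ mulmxDr -(scalemxAr q^-1) mulmxBr mulmx1 PP0_0 add0r subr0.
  by rewrite mxtraceZ mulVKf.
have ZS := inCS_casimir.
(* [W] is central, so it acts as a scalar on each [P]. That scalar is zero for [P != P0], since
   [\tr (P *m W) = 0]. *)
pose W := casimir - q^-1 *: 1%:M.
have WS : inCS S W by apply/inCSB/inCSZ/inCS1.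
have Wc M : inCS S M -> W *m M = M *m W.
  by move=> MS; rewrite /W mulmxBl mulmxBr casimir_central // -scalemxAl -scalemxAr mul1mx mulmx1.
have : (1%:M - P0) *m W = 0.
  apply: (central_idem_P0_ind (R := fun Q => Q *m W = 0)) => [|P cP PP0|Q1 Q2 e1 e2].
  - by rewrite mul0mx.
  - have [c hc] := cpi_central_scalar cP WS Wc.
    have : \tr (P *m W) = 0.
      rewrite /W mulmxBr raddfB /= cpi_mxtrace_casimir // -scalemxAr mulmx1 mxtraceZ h //.
      by rewrite mulKf // subrr.
    rewrite hc mxtraceZ => /eqP; rewrite mulf_eq0 (gt_eqF (cpi_mxtrace cP).2) orbF.
    by move/eqP->; rewrite scale0r.
  by rewrite mulmxDl e1 e2 addr0.
rewrite /W mulmxBr -(scalemxAr q^-1) mulmx1 mulmxBl mul1mx -casimir_central ?casimir_P0;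
  last exact: inCS_P0.
by move/eqP; rewrite subr_eq0 subr_eq addrC => /eqP.
Qed.

Lemma mxtrace_adj_offdiag s : s \in Ssharp S -> \tr (A s) = 0.
Proof.
rewrite !inE => /andP[sd sS]; rewrite /mxtrace big1 // => i _.
by rewrite adjmxE // cls_refl eq_sym (negPf sd).
Qed.

(** [\tr (A t *m (A t)^T *m A s)] sums the entries of [A s *m A t] over the class [t], where they
    are constant. The weight cancels [#|t|] and leaves an intersection number. *)
Lemma mxtrace_adj_casimir s : s \in S -> exists m : nat, \tr (casimir *m A s) = m%:R.
Proof.
move=> sS.
suff /choice[f hf] t : exists m : nat, t \in S -> wt t * \tr (A t *m (A t)^T *m A s) = m%:R.
  exists (\sum_(t in S) f t)%N; rewrite mulmx_suml raddf_sum natr_sum /=.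
  by apply: eq_bigr => t tS; rewrite -scalemxAl mxtraceZ hf.
case: (boolP (t \in S)) => [tS|]; last by exists 0%N.
have [i [j ij]] := class_has_pair tS.
exists (inum s t (ev i) (ev j)) => _.
rewrite mxtrace_mulC mulmxA mxtrace_mul_tr -adjmx_mulE.
transitivity (wt t * ((A s *m A t) i j * #|t|%:R)); last first.
  by rewrite mulrCA mulVf ?mulr1 // -invr_eq0 wt_neq0.
congr (_ * _); rewrite -adjmx_sum mulr_sumr; apply: eq_bigr => k _.
rewrite mulr_sumr; apply: eq_bigr => l _.
rewrite [A t k l]adjmxE //; case: eqP => [kl|_]; last by rewrite !mulr0.
by have /inCSP h := inCSM (inCS_adj sS) (inCS_adj tS); rewrite (h k l i j) // kl ij.
Qed.

Lemma casimir_form_card (q : C) t : 0 < q -> casimir_form q -> t \in Ssharp S ->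
  #|t|%:R = q * n%:R.
Proof.
move=> q0 hZ; have n0 := card_base_neq0; have qn0 : q != 0 by rewrite gt_eqF.
have Ssub s : s \in Ssharp S -> s \in S by rewrite inE => /andP[].
(* [v s] is the valency of [s] divided by [q]. *)
pose v (s : {set T * T}) : C := #|s|%:R / (q * n%:R).
have v_ge1 s : s \in Ssharp S -> 0 <= v s - 1.
  move=> sS; have [m hm] := mxtrace_adj_casimir (Ssub _ sS).
  have [a _] := class_has_pair diagS.
  have cs : (#|s|%:R : C) = #|nbhd s (ev a)|%:R * n%:R by rewrite -natrM -card_class ?Ssub.
  (* As [\tr (A s) = 0], the assumed form of [casimir] gives trace [n_s - n_s / q] against [A s]. So
     [v s] is an integer, and being positive it is at least 1. *)
  have vint : v s = #|nbhd s (ev a)|%:R - m%:R.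
    rewrite -hm hZ mulmxDl -(scalemxAl q^-1) mulmxBl mul1mx mxtraceD mxtraceZ raddfB /=.
    rewrite (mxtrace_mulC P0) mxtrace_mul_P0 adjmx_sum mxtrace_adj_offdiag // /v cs.
    by field; rewrite qn0 n0.
  have v0 : 0 < v s by rewrite divr_gt0 ?ltr0n ?card_class_gt0 ?Ssub // mulr_gt0 // lt0r n0 ler0n.
  rewrite subr_ge0 vint; move: v0; rewrite vint subr_gt0 ltr_nat => lt_m.
  by rewrite -natrB ?ler1n ?subn_gt0 // ltnW.
have sum0 : \sum_(s in Ssharp S) (v s - 1) = 0.
  have e1 : \sum_(s in Ssharp S) v s = (n%:R - 1) / q.
    rewrite -mulr_suml -natr_sum.
    have := sum_card_class; rewrite (big_setD1 _ diagS) /= card_diag -/(Ssharp S) => e.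
    have -> : (\sum_(s in Ssharp S) #|s|)%:R = n%:R * n%:R - n%:R :> C.
      by rewrite -natrM -e natrD addrAC subrr add0r.
    by field; rewrite qn0 n0.
  (* The trace of [casimir] counts the classes, and its assumed form evaluates it as
     [1 + (n - 1) / q]. *)
  have e2 : #|Ssharp S|%:R = (n%:R - 1) / q.
    have := mxtrace_casimir; rewrite hZ mxtraceD mxtrace_P0 mxtraceZ raddfB /= mxtrace_P0 mxtrace1.
    rewrite (cardsD1 (diagR T) S) diagS natrD => /addrI; rewrite -/(Ssharp S) => <-.
    by rewrite mulrC.
  by rewrite sumrB e1 sumr_const -e2 subrr.
move=> tS; have := psumr_eq0P v_ge1 sum0 tS.
by move/eqP; rewrite subr_eq0 => /eqP; rewrite /v => /(canRL (mulfVK _)) ->;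
  rewrite ?mul1r ?mulf_neq0.
Qed.

Lemma sum_adj_cval i j : (\sum_(s in S) A s *m (A s)^T) i j = (cval S (ev i) (ev j))%:R.
Proof.
by rewrite summxE natr_sum; apply: eq_bigr => s _; rewrite adjmx_tr adjmx_mulE.
Qed.

(** All nondiagonal classes have weight [1 / (q * n)], and the diagonal class contributes only to
    diagonal entries. *)
Lemma casimir_offdiag (q : C) i j : q != 0 ->
  (forall t, t \in Ssharp S -> #|t|%:R = q * n%:R) -> i != j ->
  casimir i j = (cval S (ev i) (ev j))%:R / (q * n%:R).
Proof.
move=> q0 hq ij; rewrite -sum_adj_cval !summxE mulr_suml; apply: eq_bigr => s sS.
rewrite mxE /wt mulrC; case: (eqVneq s (diagR T)) => [->|sd].
  by rewrite adjmx_diag trmx1 mulmx1 mxE (negPf ij) !mul0r.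
by rewrite hq // !inE sd.
Qed.

Lemma equivalencedP k :
  equivalenced S k <-> (forall t, t \in Ssharp S -> #|t|%:R = k%:R * n%:R :> C).
Proof.
split=> [eqS t tS|h t tS a].
  have [i _] := class_has_pair diagS.
  rewrite (card_class (ev i)); last by move: tS; rewrite inE => /andP[].
  by rewrite eqS // natrM.
have := h t tS; rewrite (card_class a); last by move: tS; rewrite inE => /andP[].
rewrite natrM => /(mulIf card_base_neq0) /eqP; rewrite eqr_nat => /eqP //.
Qed.

Lemma casimir_form_equivalenced k : (0 < k)%N -> casimir_form k%:R <->
   (equivalenced S k /\ forall r, r \in Ssharp S -> forall a g : T, (a, g) \in r ->
        cval S a g = k.-1).
Proof.
move=> k_gt0; have k0 : (k%:R : C) != 0 by rewrite pnatr_eq0 -lt0n.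
have n0 := card_base_neq0.
have knk : (k.-1%:R : C) = k%:R - 1 by rewrite -subn1 natrB.
split=> [hZ|[/equivalencedP hk hc]].
  have hk t : t \in Ssharp S -> #|t|%:R = k%:R * n%:R :> C.
    by apply: casimir_form_card; rewrite ?ltr0n.
  split=> [|r rS a g agr]; first exact/equivalencedP.
  have ag : enum_rank a != enum_rank g.
    apply: contraTneq rS => /enum_rank_inj ag; rewrite !inE negb_and negbK.
    apply/orP; case: (boolP (r \in S)) => rS; [left|by right].
    rewrite -(cls_refl (enum_rank a)) eq_sym; apply/eqP/cls_eq => //.
    by rewrite enum_rankK {2}ag.
  have := casimir_offdiag k0 hk ag; rewrite !enum_rankK hZ mxE P0E !mxE (negPf ag).
  rewrite mulr1 mulr0n sub0r => e; apply/eqP; rewrite -(eqr_nat C) knk.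
  apply/eqP; apply: (mulIf (invr_neq0 (mulf_neq0 k0 n0))); rewrite -e.
  by field; rewrite k0 n0.
(* Counting all pairs by class gives [n * n = n + k * n * #|Ssharp S|]. *)
have cardS : #|S|%:R = 1 + (n%:R - 1) / k%:R :> C.
  have e : n%:R * n%:R = n%:R + k%:R * n%:R * #|Ssharp S|%:R :> C.
    rewrite -natrM -sum_card_class (big_setD1 _ diagS) /= card_diag natrD natr_sum.
    by rewrite (eq_bigr _ hk) sumr_const -[(_ * _) *+ _]mulr_natr.
  rewrite (cardsD1 (diagR T) S) diagS natrD -/(Ssharp S); congr (_ + _).
  apply: (mulIf (mulf_neq0 k0 n0)); rewrite mulrC -[LHS](addKr n%:R) -e.
  by field.
apply/matrixP=> i j; rewrite mxE P0E !mxE; case: (eqVneq i j) => [<-|ij]; last first.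
  rewrite (casimir_offdiag k0 hk ij) (hc _ _ _ _ (mem_cls i j)) ?knk;
    last by rewrite !inE cls_diag ij cls_in.
  by rewrite mulr1 mulr0n; field; rewrite k0 n0.
(* The diagonal of [casimir] is constant, hence determined by its trace, the number of classes. *)
have : \tr casimir = casimir i i * n%:R.
  transitivity (\sum_(l < n) casimir i i); last by rewrite sumr_const card_ord mulr_natr.
  apply: eq_bigr => l _.
  by have /inCSP h := inCS_casimir; rewrite (h l l i i) // !cls_refl.
rewrite mxtrace_casimir cardS => /(canLR (mulfK n0)) <-.
by rewrite mulr1 mulr1n; field; rewrite k0 n0.
Qed.

(** With only the diagonal class, [n%:R *: P0] is the identity, so [P *m P0 = 0] would give
    [P = 0]. *)
Lemma Ssharp_nonempty (P : mx) : cpi S P -> P != P0 -> exists s, s \in Ssharp S.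
Proof.
move=> cP neP; apply/set0Pn; apply: contra_neq neP => S0.
have J1 : n%:R *: P0 = 1%:M.
  apply/matrixP=> i j; rewrite mxE P0E mulfV ?card_base_neq0 // mxE -cls_diag.
  suff -> : cls i j = diagR T by rewrite eqxx.
  apply/eqP; apply: contraT => ne; have : cls i j \in Ssharp S by rewrite !inE ne cls_in.
  by rewrite S0 inE.
apply/eqP; apply: contraT => neP; case: cP (cpi_mul_P0 cP neP) => _ /eqP Pn0 _ PP0; case: Pn0.
by rewrite -[P]mulmx1 -J1 -scalemxAr PP0 scaler0.
Qed.

(* [\tr (Q *m A s) / (q * d)] is, on each [cpi], the character value at [A s], an
   algebraic integer; for [Q = 1 - P0] it equals [- 1 / d]. *)
Lemma nP_const_eq1 (q : C) (d : nat) (P1 : mx) : 0 < q -> casimir_form q ->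
  cpi S P1 -> P1 != P0 -> (forall P, cpi S P -> P != P0 -> nP S P = d) -> d = 1%N.
Proof.
move=> q0 hZ cP1 neP1 hd; have qn0 : q != 0 by rewrite gt_eqF.
have d_gt0 : (0 < d)%N by rewrite -(hd _ cP1 neP1) nP_gt0.
have dn0 : (d%:R : C) != 0 by rewrite pnatr_eq0 -lt0n.
have [s sS] := Ssharp_nonempty cP1 neP1.
have sS' : s \in S by move: sS; rewrite inE => /andP[].
apply: (@integral_natV C) => //.
pose I x := integralOver (intr : int -> C) x.
have : I (\tr ((1%:M - P0) *m A s) / (q * d%:R)).
  apply: (central_idem_P0_ind (R := fun Q => I (\tr (Q *m A s) / (q * d%:R)))).
  - by rewrite mul0mx mxtrace0 mul0r; exact: integral0.
  - move=> P cP neP; have [x Ix ->] := cpi_trace_integral cP sS'.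
    rewrite ((casimir_formP qn0).2 hZ _ cP neP) hd // natrX.
    by rewrite (_ : _ / _ = x) //; field; rewrite qn0 dn0.
  by move=> Q1 Q2 I1 I2; rewrite mulmxDl mxtraceD mulrDl; exact: integral_add.
rewrite mulmxBl mul1mx raddfB /= (mxtrace_mulC P0) mxtrace_mul_P0 adjmx_sum.
rewrite mxtrace_adj_offdiag // (casimir_form_card q0 hZ sS) => /integral_opp.
rewrite (_ : - _ = d%:R^-1) //; have n0 := card_base_neq0.
by field; rewrite qn0 dn0 n0.
Qed.

Lemma cpi_ratio (P : mx) (q : C) : cpi S P ->
  mP S P / (nP S P)%:R = q <-> \tr P = q * (nP S P ^ 2)%:R.
Proof.
move=> cP; have d0 : ((nP S P)%:R : C) != 0 by rewrite pnatr_eq0 -lt0n nP_gt0.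
rewrite /mP -(cpi_mxtrace cP).1 natrX; split=> [<-|->]; by field.
Qed.

Lemma commutative_of_nP_const : pseudocyclic C S ->
  (exists d : nat, forall P, cpi S P -> P != P0 -> nP S P = d) -> CS_commutative C S.
Proof.
move=> [q hq] [d hd] M N MS NS.
(* The commutator is killed by each [P != P0], as [n_P = 1] there. The positivity of [q] and the
   form of [casimir] are derived inside that case, where such a [P] is at hand. *)
have : (1%:M - P0) *m (M *m N - N *m M) = 0.
  apply: (central_idem_P0_ind (R := fun Q => Q *m (M *m N - N *m M) = 0)).
  - by rewrite mul0mx.
  - move=> P cP neP; rewrite mulmxBr (cpi_dim1_comm cP _ MS NS) ?subrr //.
    have trP R : cpi S R -> R != P0 -> \tr R = q * (nP S R ^ 2)%:R.
      by move=> cR neR; apply/(cpi_ratio _ cR)/hq.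
    have q0 : 0 < q.
      have := (cpi_mxtrace cP).2; rewrite trP // pmulr_lgt0 // ltr0n.
      by rewrite expn_gt0 nP_gt0.
    have hZ : casimir_form q by apply/casimir_formP; rewrite ?gt_eqF.
    by rewrite hd //; apply: (nP_const_eq1 q0 hZ cP neP hd).
  by move=> Q1 Q2 e1 e2; rewrite mulmxDl e1 e2 addr0.
(* The algebra acts on [P0] by scalars, so the commutator is killed by [P0] as well. *)
have P0M X Y : inCS S X -> inCS S Y -> P0 *m (X *m Y) = (\tr (X *m P0) * \tr (Y *m P0)) *: P0.
  by move=> XS YS; rewrite mulmxA P0_mul_inCS // -(scalemxAl (\tr _)) P0_mul_inCS // scalerA.
by rewrite mulmxBl mul1mx mulmxBr !P0M // mulrC subrr subr0 => /eqP; rewrite subr_eq0 => /eqP.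
Qed.

End AdjacencyAlgebra.

Theorem theorem2p2 (C : numClosedFieldType) (T : finType)
    (S : {set {set T * T}}) (k : nat) :
  scheme S -> (0 < k)%N ->
  ((pseudocyclic C S /\
      forall P : 'M[C]_#|T|, cpi S P -> P != P0mx C T ->
        mP S P / (nP S P)%:R = k%:R)
   <->
   (equivalenced S k /\
      forall r, r \in Ssharp S -> forall a g : T, (a, g) \in r ->
        cval S a g = k.-1))
  /\
  (pseudocyclic C S ->
   (exists d : nat, forall P : 'M[C]_#|T|, cpi S P -> P != P0mx C T -> nP S P = d) ->
   CS_commutative C S).
Proof.
move=> schS k_gt0; split; last exact: commutative_of_nP_const.
have k0 : (k%:R : C) != 0 by rewrite pnatr_eq0 -lt0n.
(* Both conditions are compared through the single matrix identity [casimir_form k%:R]. *)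
rewrite -(casimir_form_equivalenced C schS k_gt0) -casimir_formP //.
split=> [[_ h] P cP neP|h]; first by apply/(cpi_ratio _ cP)/h.
have hk P : cpi S P -> P != P0mx C T -> mP S P / (nP S P)%:R = k%:R.
  by move=> cP neP; apply/(cpi_ratio _ cP)/h.
by split=> //; exists k%:R.
Qed.
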